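(* Let $(V,m)$ be a finite-dimensional $L_\infty$ algebra and let $(V\oplus\Pi V^*,X_{D_{od}(m)})$ be its odd double. Then the following statements are equivalent. (1) The $L_\infty$ structure $(V,m)$ admits a unimodular lift. (2) The odd double $(V\oplus\Pi V^*,X_{D_{od}(m)})$ of $V$ admits a unimodular lift. (3) The odd double $(V\oplus\Pi V^*,X_{D_{od}(m)})$ of $V$ admits a quantum lift.
   Context: Conventions: the ground field $\mathbf k$ has characteristic zero; vector spaces are $\mathbb Z/2$-graded, $|x|$ is parity, $\Pi$ is parity reversion; all spaces are finite-dimensional dg. $\hat SW^*$ is the completed symmetric algebra, $\hat S_{\ge n}W^*$ the ideal of series with all monomials of length $\ge n$, $\mathrm{Der}_{\ge n}(\hat SW^* )$ the continuous derivations mapping $W^*$ into $\hat S_{\ge n}W^*$. The differential of $W$ extends to an odd derivation $d$ of $\hat SW^*$ and acts on derivations by $d(\xi)=[d,\xi]$. For $\xi=\sum_if_i\partial_{x_i}$ the divergence is $\nabla\xi=\sum_i(-1)^{|f_i||x_i|}\partial_{x_i}f_i$. An $L_\infty$ structure on $V$ is an odd $m\in\mathrm{Der}_{\ge2}(\hat S\Pi V^* )$ with $d(m)+\frac12[m,m]=0$; a unimodular lift of it is an even $f\in\hat S_{\ge1}\Pi V^*$ with $d(f)+\frac12\nabla(m)+m(f)=0$. Odd symplectic setting: let $U$ be a dg space with an odd non-degenerate symmetric form compatible with $d$. Then $\Pi U$ is odd symplectic and $\hat S\Pi U^*$ has an odd Poisson bracket with $\{f,g\}=(-1)^{|f||g|}\{g,f\}$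 and $\{f,gh\}=\{f,g\}h+(-1)^{(|f|+1)|g|}g\{f,h\}$; in Darboux coordinates $x_i,\xi_i$ ($|\xi_i|=|x_i|+1$) one has $\{x_i,\xi_j\}=\delta_{ij}$, $\{x_i,x_j\}=\{\xi_i,\xi_j\}=0$. Put $X_g=\{g,-\}$ and $\Delta=\sum_i\partial_{x_i}\partial_{\xi_i}$. An odd cyclic $L_\infty$ structure on $U$ is $X_{S_0}$ with $S_0\in\hat S_{\ge3}\Pi U^*$ even and $dS_0+\frac12\{S_0,S_0\}=0$. With $h$ an even formal parameter and $fh^g$ ($f$ a monomial of length $n$) of weight $2g+n$, let $\mathfrak h[\Pi U]\subset\hat S\Pi U^*[[h]]$ be the part of weight $>2$. A quantum lift of $X_{S_0}$ is an even $S(h)=S_0+hS_1+h^2S_2+\cdots\in\mathfrak h[\Pi U]$ with $(d+h\Delta)S(h)+\frac12\{S(h),S(h)\}=0$. Odd double: $U=V\oplus\Pi V^*$ with its canonical odd pairing between $V$ and $\Pi V^*$, so $\hat S\Pi U^*=\hat S(\Pi V^*\oplus V)$, with Darboux coordinates given by a basis $x_i$ of $\Pi V^*$ and the odd dual basis $\xi_i\in V$. For $m=\sum_if_i\partial_{x_i}$ put $D_{od}(m)=\sum_i(-1)^{|f_i|}f_i\,\xi_i\in\hat S(\Pi V^* )\otimes V\subset\hat S(\Pi V^*\oplus V)$; then $X_{D_{od}(m)}$ is an odd cyclic $L_\infty$ structure on $V\oplus\Pi V^*$, the odd double of $(V,m)$. *)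

(* Defs.v *)
From HB Require Import structures.
From mathcomp Require Import all_boot all_algebra.
From mathcomp Require Import zify ring boolp functions.
From mathcomp Require Import ssrcomplements mpoly.
Set Warnings "-redundant-canonical-projection".
Set Implicit Arguments.
Unset Strict Implicit.
Unset Printing Implicit Defensive.
Import GRing.Theory.
Local Open Scope ring_scope.

(* A finite-dimensional dg space with a chosen homogeneous basis e_0, ...,     *)
(* e_(n-1): e_i has parity par i and d e_j = \sum_i dmx i j *: e_i.            *)
Record dgspace (k : fieldType) (n : nat) := DGSpace {
  par : 'I_n -> bool;
  dmx : 'M[k]_n;
  dmx_odd : forall i j, dmx i j != 0 -> par i != par j;
  dmx_sq : dmx *m dmx = 0
}.
Arguments par {k n} d.
Arguments dmx {k n} d.

Section DGConstructions.
Variable k : fieldType.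

Section Dual.
Variables (n : nat) (V : dgspace k n).

Definition dual_dmx : 'M[k]_n :=
  \matrix_(j, i) (- (-1) ^+ par V i * dmx V i j).

Fact dual_dmx_odd i j : dual_dmx i j != 0 -> par V i != par V j.
Proof.
by rewrite mxE mulf_eq0 negb_or => /andP[_ /dmx_odd]; rewrite eq_sym.
Qed.

Fact dual_dmx_sq : dual_dmx *m dual_dmx = 0.
Proof.
apply/matrixP => i j; rewrite !mxE.
transitivity (\sum_l ((-1) ^+ (~~ par V j) * (-1) ^+ par V j)
                     * (dmx V j l * dmx V l i)).
  apply: eq_bigr => l _; rewrite !mxE.
  have [->|/dmx_odd pjl] := eqVneq (dmx V j l) 0.
    by rewrite !(mul0r, mulr0).
  have -> : par V l = ~~ par V j by move: pjl; case: (par V j); case: (par V l).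
  by rewrite mulrACA mulrNN [dmx V l i * _]mulrC.
rewrite -big_distrr /=.
by have /matrixP/(_ j i) := dmx_sq V; rewrite !mxE => ->; rewrite mulr0.
Qed.

(* The basis of V^* is the dual basis, and (d phi)(v) = - (-1)^|phi| phi (d v) *)
Definition dgdual : dgspace k n :=
  {| par := par V; dmx_odd := dual_dmx_odd; dmx_sq := dual_dmx_sq |}.

Fact Pi_dmx_odd i j : (- dmx V) i j != 0 -> ~~ par V i != ~~ par V j.
Proof.
by rewrite mxE oppr_eq0 => /dmx_odd; case: (par V i); case: (par V j).
Qed.

Fact Pi_dmx_sq : - dmx V *m - dmx V = 0.
Proof. by rewrite mulmxN mulNmx opprK dmx_sq. Qed.

(* d (Pi v) = - Pi (d v) *)
Definition dgPi : dgspace k n :=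
  {| par := fun i => ~~ par V i; dmx_odd := Pi_dmx_odd; dmx_sq := Pi_dmx_sq |}.

End Dual.

Section Sum.
Variables (n1 n2 : nat) (V1 : dgspace k n1) (V2 : dgspace k n2).

Definition sum_par (i : 'I_(n1 + n2)) : bool :=
  match fintype.split i with inl i1 => par V1 i1 | inr i2 => par V2 i2 end.

Definition sum_dmx : 'M[k]_(n1 + n2) := block_mx (dmx V1) 0 0 (dmx V2).

Fact sum_dmx_odd i j : sum_dmx i j != 0 -> sum_par i != sum_par j.
Proof.
rewrite /sum_par !mxE; case: (fintype.split i) => i'; rewrite !mxE;
  case: (fintype.split j) => j'; rewrite ?mxE ?eqxx //; exact: dmx_odd.
Qed.

Fact sum_dmx_sq : sum_dmx *m sum_dmx = 0.
Proof.
by rewrite mulmx_block !(mulmx0, mul0mx) !dmx_sq !addr0 block_mx_const.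
Qed.

Definition dgsum : dgspace k (n1 + n2) :=
  {| par := sum_par; dmx_odd := sum_dmx_odd; dmx_sq := sum_dmx_sq |}.

End Sum.
End DGConstructions.

Definition dgdouble k n (V : dgspace k n) : dgspace k (n + n) :=
  dgsum V (dgPi (dgdual V)).

Section CompletedSymmetricAlgebra.
Variables (k : fieldType) (n : nat).

(* Monomials x_0^(m 0) ... x_(n-1)^(m (n-1)), in this order, in generators     *)
(* x_i of parity p i: an odd generator occurs at most once.                    *)
Definition adm (p : 'I_n -> bool) (m : 'X_{1..n}) : bool :=
  [forall i, p i ==> (m i <= 1)%N].

Definition smonom (p : 'I_n -> bool) := {m : 'X_{1..n} | adm p m}.

Definition mpar (p : 'I_n -> bool) (m : 'X_{1..n}) : bool :=
  odd (\sum_(i < n | p i) m i)%N.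

(* The Koszul sign in x^a * x^b = ksign p a b *: x^(a + b).                    *)
Definition ksign (p : 'I_n -> bool) (a b : 'X_{1..n}) : k :=
  (-1) ^+ (\sum_(i < n) \sum_(j < n | (j < i)%N && (p i && p j)) a i * b j)%N.

(* The completed symmetric algebra on a space of generators G, as formal       *)
(* series.                                                                     *)
Definition csym (G : dgspace k n) : Type := smonom (par G) -> k^o.

HB.instance Definition _ (G : dgspace k n) := GRing.Lmodule.on (csym G).

Variable G : dgspace k n.
Local Notation p := (par G).
Implicit Types (f g h : csym G) (m : 'X_{1..n}).

Definition coef f m : k := if insub m is Some u then f u else 0.

Definition csym_mul f g : csym G := fun u =>
  \sum_(a : 'X_{1..n < (mdeg (val u)).+1} | (a <= val u)%MM)
     ksign p a (val u - a) * (coef f a * coef g (val u - a)).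

Definition csym_one : csym G := fun u => (val u == 0%MM)%:R.

Lemma csymP f g : (forall m, adm p m -> coef f m = coef g m) <-> f = g.
Proof.
split=> [fg|-> //]; apply/funext => u.
by have := fg (val u) (valP u); rewrite /coef valK.
Qed.

Lemma coef_fun (c : 'X_{1..n} -> k) m : adm p m ->
  coef (fun u => c (val u) : k^o) m = c m.
Proof. by move=> pm; rewrite /coef insubT. Qed.

Lemma coef_nadm f m : ~~ adm p m -> coef f m = 0.
Proof. by move=> pm; rewrite /coef insubN. Qed.

Lemma coefD f g m : coef (f + g) m = coef f m + coef g m.
Proof. by rewrite /coef; case: insubP => [//|_]; rewrite addr0. Qed.

Lemma coefZ a f m : coef (a *: f) m = a * coef f m.
Proof. by rewrite /coef; case: insubP => [//|_]; rewrite mulr0. Qed.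

Lemma adm_le m1 m2 : (m1 <= m2)%MM -> adm p m2 -> adm p m1.
Proof.
move=> /mnm_lepP le12 /forallP a2; apply/forallP => i; apply/implyP => pi.
exact: leq_trans (le12 i) (implyP (a2 i) pi).
Qed.

Lemma adm0 : adm p 0%MM.
Proof. by apply/forallP => i; rewrite mnm0E implybT. Qed.

Lemma ksignDl a b c : ksign p (a + b) c = ksign p a c * ksign p b c.
Proof.
rewrite /ksign -exprD -big_split /=; congr (_ ^+ _).
apply: eq_bigr => i _; rewrite -big_split /=; apply: eq_bigr => j _.
by rewrite mnmDE mulnDl.
Qed.

Lemma ksignDr a b c : ksign p c (a + b) = ksign p c a * ksign p c b.
Proof.
rewrite /ksign -exprD -big_split /=; congr (_ ^+ _).
apply: eq_bigr => i _; rewrite -big_split /=; apply: eq_bigr => j _.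
by rewrite mnmDE mulnDr.
Qed.

Lemma ksign0r a : ksign p a 0 = 1.
Proof.
rewrite /ksign big1 ?expr0 // => i _; rewrite big1 // => j _.
by rewrite mnm0E muln0.
Qed.

Lemma ksign0l a : ksign p 0 a = 1.
Proof.
rewrite /ksign big1 ?expr0 // => i _; rewrite big1 // => j _.
by rewrite mnm0E mul0n.
Qed.

Lemma coefM f g m b : adm p m -> (mdeg m < b)%N ->
  coef (csym_mul f g) m =
    \sum_(a : 'X_{1..n < b} | (a <= m)%MM)
       ksign p a (m - a) * (coef f a * coef g (m - a)).
Proof.
move=> pm lt_m_b.
pose c m' := \sum_(a : 'X_{1..n < (mdeg m').+1} | (a <= m')%MM)
  ksign p a (m' - a) * (coef f a * coef g (m' - a)).
rewrite (@coef_fun c) // /c.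
rewrite (big_sub_widen 'X_{1..n < (mdeg m).+1} 'X_{1..n < b}
  (fun a => a <= m)%MM
  (fun a => ksign p a (m - a) * (coef f a * coef g (m - a)))) /=; last first.
  by move=> x /leq_trans; apply.
apply: eq_bigl => a; case le_am: (a <= m)%MM => //=.
by rewrite ltnS mdegE [mdeg m]mdegE leq_sum // => i _; apply/mnm_lepP.
Qed.

Lemma coefM_rev f g m b : adm p m -> (mdeg m < b)%N ->
  coef (csym_mul f g) m =
    \sum_(a : 'X_{1..n < b} | (a <= m)%MM)
       ksign p (m - a) a * (coef f (m - a) * coef g a).
Proof.
move=> pm lt; rewrite (coefM f g pm lt).
have pr (h : 'X_{1..n}) : (mdeg (m - h) < b)%N.
  exact: leq_ltn_trans (mdegB _ _) _.
pose F (a : 'X_{1..n < b}) := BMultinom (pr a).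
have inv_F (h : 'X_{1..n}): (h <= m)%MM -> (m - (m - h))%MM = h.
  by move=> le_hm; rewrite submBA // addmC addmK.
rewrite (reindex_onto F F) //=; last first.
  by move=> h /inv_F eqh; apply/eqP; rewrite eqE /= eqh.
apply: eq_big => [h /=|h /andP[_ /eqP/(congr1 val)/= -> //]].
rewrite lem_subr eqE /=.
by apply/eqP/idP => [<-|/inv_F //]; apply/mnm_lepP=> i; rewrite !mnmBE leq_subr.
Qed.

Fact csym_mulA : associative csym_mul.
Proof.
move=> f g h; apply/csymP => m pm.
pose b := (mdeg m).+1; have ltb : (mdeg m < b)%N by [].
rewrite (coefM _ _ pm ltb) (coefM_rev _ _ pm ltb).
have ltB m' : (mdeg (m - m') < b)%N by exact: leq_ltn_trans (mdegB m m') _.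
have pB m' : adm p (m - m') by exact: adm_le (lem_subr _ _) pm.
pose F a c := ksign p a (m - a) * ksign p (m - a - c) c *
  (coef f a * (coef g (m - a - c)%MM * coef h c)).
transitivity (\sum_(a : 'X_{1..n < b} | (a <= m)%MM)
                \sum_(c : 'X_{1..n < b} | (c <= m - a)%MM) F a c).
  apply: eq_bigr => a _; rewrite (coefM_rev _ _ (pB a) (ltB a)).
  rewrite big_distrr big_distrr /=; apply: eq_bigr => c _.
  by rewrite /F -!mulrA; congr (_ * _); rewrite mulrCA.
rewrite (exchange_big_dep (fun c : 'X_{1..n < b} => (c <= m)%MM)) //=; last first.
  by move=> a c _ /lepm_trans; apply; apply: lem_subr.
apply: eq_bigr => c lecm.
rewrite (coefM _ _ (pB c) (ltB c)) big_distrl big_distrr /=.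
apply: eq_big => [a|a /andP[leam lecma]].
  apply/andP/idP => [[/mnm_lepP lea /mnm_lepP lec]|lea].
    apply/mnm_lepP => i; move: (lea i) (lec i); rewrite !mnmBE => leai leci.
    by rewrite leq_subRL ?(leq_trans leci) ?leq_subr // addnC -leq_subRL.
  have leam : (a <= m)%MM by rewrite (lepm_trans lea) ?lem_subr.
  split=> //; apply/mnm_lepP => i; move/mnm_lepP/(_ i): lea.
  move/mnm_lepP/(_ i): lecm; move/mnm_lepP/(_ i): leam; rewrite !mnmBE => ? ?.
  by rewrite leq_subRL // addnC -leq_subRL.
have e1 : (m - a = (m - a - c) + c)%MM by rewrite submK.
have e2 : (m - c = a + (m - a - c))%MM.
  apply/mnmP => i; rewrite mnmDE !mnmBE.
  move/mnm_lepP/(_ i): leam; move/mnm_lepP/(_ i): lecma; rewrite mnmBE.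
  by move: (m i) (a i) (c i) => x y z; lia.
have e3 : (m - c - a = m - a - c)%MM by rewrite !submDA addmC.
rewrite /F e3 [in ksign p a (m - a)]e1 [in ksign p (m - c) c]e2.
rewrite ksignDl ksignDr.
ring.
Qed.

Fact csym_mul1l : left_id csym_one csym_mul.
Proof.
move=> f; apply/csymP => m pm; rewrite (coefM _ _ pm (ltnSn _)).
have lt0 : (mdeg (0%MM : 'X_{1..n}) < (mdeg m).+1)%N by rewrite mdeg0.
have c1 m' : adm p m' -> coef csym_one m' = (m' == 0%MM)%:R.
  exact: (@coef_fun (fun m' => (m' == 0%MM)%:R)).
rewrite (bigD1 (BMultinom lt0)) /=; last by apply/mnm_lepP => i; rewrite mnm0E.
rewrite c1 ?adm0 // eqxx mul1r ksign0l mul1r subm0 big1 ?addr0 // => a.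
move=> /andP[lea ne0]; rewrite c1 ?(adm_le lea) //.
by rewrite -[_ == 0%MM]/(val a == val (BMultinom lt0)) val_eqE (negPf ne0) mul0r mulr0.
Qed.

Fact csym_mul1r : right_id csym_one csym_mul.
Proof.
move=> f; apply/csymP => m pm; rewrite (coefM_rev _ _ pm (ltnSn _)).
have lt0 : (mdeg (0%MM : 'X_{1..n}) < (mdeg m).+1)%N by rewrite mdeg0.
have c1 m' : adm p m' -> coef csym_one m' = (m' == 0%MM)%:R.
  exact: (@coef_fun (fun m' => (m' == 0%MM)%:R)).
rewrite (bigD1 (BMultinom lt0)) /=; last by apply/mnm_lepP => i; rewrite mnm0E.
rewrite c1 ?adm0 // eqxx mulr1 ksign0r mul1r subm0 big1 ?addr0 // => a.
move=> /andP[lea ne0]; rewrite c1 ?(adm_le lea) //.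
by rewrite -[_ == 0%MM]/(val a == val (BMultinom lt0)) val_eqE (negPf ne0) !mulr0.
Qed.

Fact csym_mulDl : left_distributive csym_mul +%R.
Proof.
move=> f g h; apply/csymP => m pm; rewrite coefD !(coefM _ _ pm (ltnSn _)).
by rewrite -big_split /=; apply: eq_bigr => a _; rewrite coefD mulrDl mulrDr.
Qed.

Fact csym_mulDr : right_distributive csym_mul +%R.
Proof.
move=> f g h; apply/csymP => m pm; rewrite coefD !(coefM _ _ pm (ltnSn _)).
by rewrite -big_split /=; apply: eq_bigr => a _; rewrite coefD !mulrDr.
Qed.

Fact csym_one_neq0 : csym_one != 0.
Proof.
apply/eqP => /(congr1 (fun f : csym G => f (exist _ 0%MM adm0))) /eqP.
by rewrite /csym_one /= eqxx oner_eq0.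
Qed.

HB.instance Definition _ := GRing.Zmodule_isNzRing.Build (csym G)
  csym_mulA csym_mul1l csym_mul1r csym_mulDl csym_mulDr csym_one_neq0.

Fact csym_scaleAl (a : k) (f g : csym G) : a *: (f * g) = (a *: f) * g.
Proof.
apply/csymP => m pm; rewrite coefZ !(coefM _ _ pm (ltnSn _)) big_distrr /=.
by apply: eq_bigr => b _; rewrite coefZ; ring.
Qed.

Fact csym_scaleAr (a : k) (f g : csym G) : a *: (f * g) = f * (a *: g).
Proof.
apply/csymP => m pm; rewrite coefZ !(coefM _ _ pm (ltnSn _)) big_distrr /=.
by apply: eq_bigr => b _; rewrite coefZ; ring.
Qed.

HB.instance Definition _ :=
  GRing.Lmodule_isLalgebra.Build k (csym G) csym_scaleAl.
HB.instance Definition _ :=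
  GRing.Lalgebra_isAlgebra.Build k (csym G) csym_scaleAr.

End CompletedSymmetricAlgebra.

Section Calculus.
Variables (k : fieldType) (n : nat) (G : dgspace k n).
Local Notation p := (par G).
Implicit Types (f : csym G) (X Y : csym G -> csym G).

Definition gen (i : 'I_n) : csym G := fun u => (val u == U_(i)%MM)%:R.

(* f is homogeneous of parity b *)
Definition has_parity (b : bool) f : Prop :=
  forall u, f u != 0 -> mpar p (val u) = b.

(* f lies in \hat S_{>= N} *)
Definition order_ge (N : nat) f : Prop :=
  forall u, (mdeg (val u) < N)%N -> f u = 0.

(* f |-> (-1)^(b |f|) f, extended linearly to inhomogeneous f *)
Definition parity_sign (b : bool) f : csym G :=
  fun u => (-1) ^+ (b && mpar p (val u)) * f u.

(* The left partial derivative: the sign comes from                            *)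
(* x^(U_i + m) = ksign U_i m *: x_i * x^m.                                     *)
Definition der (i : 'I_n) f : csym G := fun u =>
  ksign k p U_(i) (val u) * (val u i).+1%:R * coef f (val u + U_(i)).

(* The differential of G extended to the completed symmetric algebra           *)
Definition dsym f : csym G :=
  \sum_i (\sum_j dmx G j i *: gen j) * der i f.

(* Continuity is for the filtration by the ideals order_ge N. *)
Definition is_derivation (b : bool) X : Prop :=
  [/\ linear X,
      forall a f, has_parity a f -> has_parity (b (+) a) (X f),
      forall a f g, has_parity a f ->
        X (f * g) = X f * g + (-1) ^+ (b && a) *: (f * X g)
    & forall N, exists M, forall f, order_ge M f -> order_ge N (X f)].

Definition der_ge (N : nat) X : Prop := forall i, order_ge N (X (gen i)).

(* The supercommutator of operators of parities a and b *)
Definition scomm (a b : bool) X Y : csym G -> csym G :=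
  fun f => X (Y f) - (-1) ^+ (a && b) *: Y (X f).

(* For X = \sum_i f_i d/dx_i one has f_i = X (gen i).                          *)
Definition divergence X : csym G :=
  \sum_i der i (parity_sign (p i) (X (gen i))).

End Calculus.

(* The dg algebra of formal functions on Pi V: series in the basis x_i of     *)
(* Pi V^* dual to e_i, |x_i| = par V i + 1.                                    *)
Notation cfun V := (csym (dgPi (dgdual V))).

Section Linfty.
Variables (k : fieldType) (n : nat) (V : dgspace k n).
Implicit Types (m : cfun V -> cfun V) (f : cfun V).

Definition Linfty_structure m : Prop :=
  [/\ is_derivation true m, der_ge 2 m
    & forall f, scomm true true (@dsym k n _) m f
                + 2^-1 *: scomm true true m m f = 0].

Definition unimodular_lift m f : Prop :=
  [/\ has_parity false f, order_ge 1 f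
    & dsym f + 2^-1 *: divergence m + m f = 0].

End Linfty.

(* Darboux coordinates: x_i is the i-th generator, xi_i the (n + i)-th.        *)
Section OddSymplectic.
Variables (k : fieldType) (n : nat) (G : dgspace k (n + n)).
Local Notation x := (@lshift n n).
Local Notation xi := (@rshift n n).
Implicit Types (f g : csym G).

(* {f, g} = \sum_i (-1)^(|x_i||f|) (d f/d xi_i) (d g/d x_i)                    *)
(*               + (-1)^(|xi_i||f|) (d f/d x_i) (d g/d xi_i),                  *)
(* the bracket determined by the derivation and symmetry rules and the         *)
(* normalisation {x_i, xi_j} = delta_ij.                                       *)
Definition poisson f g : csym G :=
  \sum_i (der (xi i) (parity_sign (par G (x i)) f) * der (x i) g
          + der (x i) (parity_sign (par G (xi i)) f) * der (xi i) g).

Definition laplacian f : csym G := \sum_i der (x i) (der (xi i) f).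

(* S represents S_0 + h S_1 + h^2 S_2 + ...; the last condition is the         *)
(* coefficient of h^r in (d + h Delta) S + 1/2 {S, S} = 0.                     *)
Definition quantum_lift (S0 : csym G) (S : nat -> csym G) : Prop :=
  [/\ S 0%N = S0,
      forall r, has_parity false (S r),
      forall r u, S r u != 0 -> (2 < 2 * r + mdeg (val u))%N
    & forall r, dsym (S r) + (if r is r'.+1 then laplacian (S r') else 0)
                + 2^-1 *: (\sum_(a < r.+1) poisson (S a) (S (r - a)%N)) = 0].

End OddSymplectic.

Section OddDouble.
Variables (k : fieldType) (n : nat) (V : dgspace k n).

(* Pi U^* for U = V (+) Pi V^* is Pi V^* (+) V; its generators are x_i         *)
(* (index lshift n i) and xi_i = e_i (index rshift n i), and dgdual and dgPi   *)
(* give d xi_j = \sum_i dmx V i j *: xi_i, the differential of V.              *)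
(* incl includes the series in the x_i only.                                   *)
Definition incl (f : cfun V) : cfun (dgdouble V) := fun u =>
  if [forall j, val u (rshift n j) == 0%N]
  then coef f [multinom val u (lshift n i) | i < n] else 0.

Definition D_od (m : cfun V -> cfun V) : cfun (dgdouble V) :=
  \sum_i parity_sign true (incl (m (gen i))) * gen (rshift n i).

End OddDouble.

(* Main.v *)
From HB Require Import structures.
From mathcomp Require Import all_boot all_algebra.
From mathcomp Require Import ring ssrcomplements mpoly.
Require Import Defs.
Set Implicit Arguments.
Unset Strict Implicit.
Unset Printing Implicit Defensive.
Import GRing.Theory.
Local Open Scope ring_scope.

(** All three statements amount to the solvability of one equation, the
    coefficient of [h] in the quantum master equation.

    Write [S0] for [D_od m].  It is linear in the coordinates [xi_i], and the
    coefficient of [xi_i] is, up to sign, [m (x_i)]; hence, writing [Delta] for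
    the odd Laplacian and identifying a series in the [x_i] with its image in
    the functions on the double,
      - [{S0, S0} / 2 + d S0 = 0], which is the Maurer-Cartan equation of [m]
        evaluated on the generators [x_i] (lemma [D_od_master]);
      - [{S0, f} = m f] for every series [f] in the [x_i] only
        (lemma [poisson_D_od_incl]);
      - [Delta S0] is the divergence of [m] (lemma [laplacian_D_od]), while the
        divergence of the Hamiltonian vector field [{S0, -}] is [2 Delta S0]
        (lemma [divergence_poisson]).
    A unimodular lift of the double is therefore an even [F] with
    [d F + Delta S0 + {S0, F} = 0], and this is the equation satisfied by the
    first-order term [S 1] of any quantum lift
    (lemma [quantum_lift_unimodular]).

    Setting all [xi_i] to zero is a ring morphism [restr] that commutes with [d]
    and turns [{S0, -}] into [m], because [S0] and its derivatives along the
    [x_i] vanish there.  So it sends a solution [F] to [2 f] with [f] a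
    unimodular lift of [m] (lemma [unimodular_lift_restr]).  Conversely, if [f]
    is a unimodular lift of [m] then [S0 + 2 h f] is a quantum lift: the
    coefficients of [h^2] and beyond vanish since [Delta f] and [{f, f}] do, no
    [xi_i] occurring in [f] (lemma [unimodular_quantum_lift]).

    The identity [{S0, f} = m f] needs [m f = \sum_i m (x_i) * d f / d x_i] for
    power series and not merely for polynomials; this is where the continuity of
    derivations enters (lemma [derivation_expansion]). *)

(** * Koszul signs, parity and order of formal series *)
Section Algebra.
Variables (k : fieldType) (n : nat) (G : dgspace k n).
Local Notation p := (par G).
Implicit Types (f g : csym G) (a b u : 'X_{1..n}) (i j : 'I_n).

Lemma coef_val f (u : smonom p) : coef f (val u) = f u.
Proof. by rewrite /coef valK. Qed.

Lemma coef0 u : coef (0 : csym G) u = 0.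
Proof. by rewrite /coef; case: insubP. Qed.

Lemma coefN f u : coef (- f) u = - coef f u.
Proof. by rewrite -scaleN1r coefZ mulN1r. Qed.

Lemma coef_sum I (r : seq I) (P : pred I) (F : I -> csym G) u :
  coef (\sum_(i <- r | P i) F i) u = \sum_(i <- r | P i) coef (F i) u.
Proof.
by elim/big_rec2: _ => [|i c f _ <-]; [exact: coef0 | rewrite coefD].
Qed.

Lemma coef_der i f u :
  coef (der i f) u = ksign k p U_(i) u * (u i).+1%:R * coef f (u + U_(i)).
Proof.
case: (boolP (adm p u)) => pu.
  exact: (@coef_fun _ _ _ (fun u =>
    ksign k p U_(i) u * (u i).+1%:R * coef f (u + U_(i)))).
rewrite !coef_nadm ?mulr0 //; apply: contraNN pu.
by apply: adm_le; apply: lem_addr.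
Qed.

Lemma coef_gen i u : adm p u -> coef (gen i : csym G) u = (u == U_(i)%MM)%:R.
Proof. exact: (@coef_fun _ _ _ (fun u => (u == U_(i)%MM)%:R)). Qed.

Lemma coef_one u : coef (1 : csym G) u = (u == 0%MM)%:R.
Proof.
case: (boolP (adm p u)) => pu.
  exact: (@coef_fun _ _ _ (fun u => (u == 0%MM)%:R)).
by rewrite coef_nadm //; case: eqP pu => // ->; rewrite adm0.
Qed.

Lemma coef_parity_sign c f u :
  coef (parity_sign c f) u = (-1) ^+ (c && mpar p u) * coef f u.
Proof.
case: (boolP (adm p u)) => pu; last by rewrite !coef_nadm ?mulr0.
rewrite /parity_sign -(@coef_fun _ _ _ (fun u =>
  (-1) ^+ (c && mpar p u) * coef f u) _ pu).
by rewrite /coef insubT //= /coef insubT.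
Qed.

Lemma has_parityP c f :
  has_parity c f <-> forall u, coef f u != 0 -> mpar p u = c.
Proof.
split=> [fc u|fc u]; last by rewrite -coef_val => /fc.
by rewrite /coef; case: insubP => [v _ <- /fc //|]; rewrite eqxx.
Qed.

Lemma order_geP N f :
  order_ge N f <-> forall u, (mdeg u < N)%N -> coef f u = 0.
Proof.
split=> [fN u|fN u /fN]; last by rewrite coef_val.
by rewrite /coef; case: insubP => [v _ <- /fN //|].
Qed.

Lemma mparD a b : mpar p (a + b) = mpar p a (+) mpar p b.
Proof.
rewrite /mpar -oddD -big_split; congr odd.
by apply: eq_bigr => i _; rewrite mnmDE.
Qed.

Lemma mparU i : mpar p U_(i) = p i.
Proof.
rewrite /mpar big_mkcond (bigD1 i) //= big1 => [|j ne]; rewrite mnm1E.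
  by rewrite eqxx addn0; case: (p i).
by rewrite eq_sym (negPf ne) if_same.
Qed.

Lemma ksignUU i j : i != j ->
  ksign k p U_(i) U_(j) * ksign k p U_(j) U_(i) = (-1) ^+ (p i && p j).
Proof.
have ksE i' j' : ksign k p U_(i') U_(j') =
   (-1) ^+ [&& (j' < i')%N, p i' & p j'].
  rewrite /ksign (bigD1 i') //= [X in (_ + X)%N]big1 ?addn0; last first.
    move=> l ne; apply: big1 => l' _.
    by rewrite mnm1E eq_sym (negPf ne).
  rewrite big_mkcond (bigD1 j') //= big1 ?addn0; last first.
    move=> l ne; rewrite [X in (_ * X)%N]mnm1E eq_sym (negPf ne) muln0.
    by rewrite if_same.
  by rewrite !mnm1E !eqxx; case: ifP.
rewrite !ksE -val_eqE neq_ltn => /orP[] lt; rewrite lt ltnNge (ltnW lt) /=.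
  by rewrite expr0 mul1r andbC.
by rewrite expr0 mulr1.
Qed.

Lemma ksign_sqr a b : ksign k p a b * ksign k p a b = 1.
Proof. by rewrite /ksign -expr2 sqrr_sign. Qed.

(** Only the pairs of two odd generators in the two factors contribute to the
    product of the two Koszul signs; a pair of equal odd generators cannot occur
    because the product monomial contains each of them at most once. *)
Lemma ksignC a b : adm p (a + b) ->
  ksign k p a b = (-1) ^+ (mpar p a && mpar p b) * ksign k p b a.
Proof.
move=> /forallP ab.
suff E : ksign k p a b * ksign k p b a = (-1) ^+ (mpar p a && mpar p b).
  by rewrite -E -mulrA ksign_sqr mulr1.
rewrite /ksign -exprD [RHS](_ : _ = (-1) ^+ (mpar p a * mpar p b)%N); last first.
  by rewrite mulnb.
rewrite -[LHS]signr_odd -[RHS]signr_odd; congr ((-1) ^+ nat_of_bool _).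
rewrite oddM /mpar !oddb -oddM; congr odd.
rewrite big_distrlr /=.
rewrite [X in (_ + X)%N](exchange_big_dep predT) //= -big_split /=.
rewrite [RHS]big_mkcond /=.
apply: eq_bigr => i _; case: (boolP (p i)) => pi; last first.
  by rewrite !big_pred0 // => j; rewrite ?andbF.
rewrite [RHS](bigID (fun j : 'I_n => (j < i)%N)) /=; congr (_ + _)%N.
  by apply: eq_bigl => j; rewrite andbC.
rewrite [RHS](bigID (pred1 i)) /= [X in (X + _)%N]big1 ?add0n.
  apply: eq_big => [j|j _]; last exact: mulnC.
  rewrite andbT -leqNgt ltn_neqAle andbC -andbA [(i <= j)%N && _]andbC.
  by rewrite eq_sym.
move=> j /andP[_ /eqP ->]; have := implyP (ab i) pi; rewrite mnmDE.
by case: (a i) => [|[|?]]; case: (b i).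
Qed.

(** Supercommutativity: the sign rule [ksignC] applied to each pair of
    complementary monomials. *)
Lemma csym_mulC c c' f g : has_parity c f -> has_parity c' g ->
  f * g = (-1) ^+ (c && c') *: (g * f).
Proof.
move=> /has_parityP fc /has_parityP gc; apply/csymP => u pu.
rewrite coefZ (coefM _ _ pu (ltnSn _)) (coefM_rev _ _ pu (ltnSn _)).
rewrite big_distrr /=.
apply: eq_bigr => a le_au.
have [->|fa] := eqVneq (coef f a) 0; first by rewrite !(mul0r, mulr0).
have [->|ga] := eqVneq (coef g (u - a)) 0; first by rewrite !(mul0r, mulr0).
rewrite ksignC 1?addmC ?submK // (fc _ fa) (gc _ ga); ring.
Qed.

Lemma has_parityM c c' f g : has_parity c f -> has_parity c' g ->
  has_parity (c (+) c') (f * g).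
Proof.
move=> /has_parityP fc /has_parityP gc; apply/has_parityP => u.
apply: contraNeq => neq; case: (boolP (adm p u)) => pu; last by rewrite coef_nadm.
rewrite (coefM _ _ pu (ltnSn _)) big1 // => a le_au.
apply/eqP; apply: contraNT neq; rewrite !mulf_eq0 !negb_or => /and3P[_ fa ga].
by rewrite -(submK le_au) mparD (fc _ fa) (gc _ ga) addbC.
Qed.

Lemma order_geM N N' f g : order_ge N f -> order_ge N' g ->
  order_ge (N + N') (f * g).
Proof.
move=> /order_geP fN /order_geP gN; apply/order_geP => u lt_u.
case: (boolP (adm p u)) => pu; last by rewrite coef_nadm.
rewrite (coefM _ _ pu (ltnSn _)) big1 // => a le_au.
have [lta|lea] := ltnP (mdeg a) N; first by rewrite fN // mul0r mulr0.
rewrite gN ?mulr0 //.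
have := mdegD (u - a) a; rewrite submK // => e.
rewrite -(ltn_add2l N); apply: leq_ltn_trans lt_u.
by rewrite [leqRHS]e addnC leq_add2l.
Qed.

Lemma has_parity_gen i : has_parity (p i) (gen i : csym G).
Proof.
by move=> u; rewrite /gen; case: (val u =P _) => [->|_]; rewrite ?mparU ?eqxx.
Qed.

Lemma order_ge_gen i : order_ge 1 (gen i : csym G).
Proof.
by move=> u; rewrite /gen; case: (val u =P _) => // ->; rewrite mdeg1.
Qed.

Lemma has_parity_der c i f : has_parity c f -> has_parity (c (+) p i) (der i f).
Proof.
move=> /has_parityP fc; apply/has_parityP => u.
rewrite coef_der mulf_eq0 negb_or => /andP[_ /fc].
by rewrite mparD mparU => <-; rewrite addbK.
Qed.

Lemma has_parity0 c : has_parity c (0 : csym G).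
Proof. by move=> u; rewrite eqxx. Qed.

Lemma has_parityD c f g : has_parity c f -> has_parity c g -> has_parity c (f + g).
Proof.
move=> /has_parityP fc /has_parityP gc; apply/has_parityP => u; rewrite coefD.
by have [->|/fc //] := eqVneq (coef f u) 0; rewrite add0r => /gc.
Qed.

Lemma has_parityZ c (t : k) f : has_parity c f -> has_parity c (t *: f).
Proof.
move=> /has_parityP fc; apply/has_parityP => u; rewrite coefZ mulf_eq0 negb_or.
by move=> /andP[_ /fc].
Qed.

Lemma has_parity_sum c I (r : seq I) (P : pred I) (F : I -> csym G) :
  (forall l, P l -> has_parity c (F l)) -> has_parity c (\sum_(i <- r | P i) F i).
Proof.
by move=> FP; elim/big_ind: _ => //; [apply: has_parity0 | apply: has_parityD].
Qed.

Lemma order_geZ N (t : k) f : order_ge N f -> order_ge N (t *: f).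
Proof.
move=> /order_geP fN; apply/order_geP => u /fN.
by rewrite coefZ => ->; rewrite mulr0.
Qed.

Lemma order_ge_sum N I (r : seq I) (P : pred I) (F : I -> csym G) :
  (forall l, P l -> order_ge N (F l)) -> order_ge N (\sum_(i <- r | P i) F i).
Proof.
move=> FP; apply/order_geP => u lt_u; rewrite coef_sum big1 // => i /FP /order_geP.
exact.
Qed.

Lemma parity_signE c c' f : has_parity c' f ->
  parity_sign c f = (-1) ^+ (c && c') *: f.
Proof.
move=> /has_parityP fc; apply/csymP => u pu; rewrite coef_parity_sign coefZ.
by have [->|/fc ->] := eqVneq (coef f u) 0; rewrite ?mulr0.
Qed.

Lemma der_linear i : linear (der i : csym G -> csym G).
Proof.
move=> t f g; apply/csymP => u _; rewrite !(coefD, coefZ, coef_der); ring.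
Qed.

HB.instance Definition _ i :=
  GRing.isLinear.Build k (csym G) (csym G) *:%R (der i) (der_linear i).

(** Over an odd generator the formula relies on [u] being admissible: otherwise
    the product vanishes while the right-hand side may not. *)
Lemma coef_genM i f u : adm p u ->
  coef (gen i * f) u =
    if (u i == 0)%N then 0 else ksign k p U_(i) (u - U_(i)) * coef f (u - U_(i)).
Proof.
move=> pu; rewrite (coefM _ _ pu (ltnSn _)).
case: ifP => [ui|/negbT ui].
  rewrite big1 // => a le_au; rewrite coef_gen ?(adm_le le_au) //.
  case: eqP => [ea|_]; last by rewrite !(mul0r, mulr0).
  by move: le_au ui; rewrite ea lep1mP => /negPf ->.
have leU : (U_(i) <= u)%MM by rewrite lep1mP.
have ltU : (mdeg (U_(i)%MM : 'X_{1..n}) < (mdeg u).+1)%N.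
  by rewrite ltnS -[in leqRHS](submK leU) mdegD leq_addl.
rewrite (bigD1 (BMultinom ltU)) //= coef_gen ?(adm_le leU) // eqxx mul1r.
rewrite big1 ?addr0 // => a /andP[le_au ne].
rewrite coef_gen ?(adm_le le_au) //.
rewrite -[_ == U_(i)%MM]/(val a == val (BMultinom ltU)) val_eqE (negPf ne).
by rewrite mul0r mulr0.
Qed.

(** The Leibniz rule with a generator as one factor is all that is needed of
    the calculus below, since derivations are compared on monomials and [D_od m]
    is linear in the [xi_i].  It is checked coefficient by coefficient; for
    [i = j] odd, both sides vanish on the monomials that already contain the
    generator. *)
Lemma der_genM j i f :
  der j (gen i * f) = (j == i)%:R *: f
                        + (-1) ^+ (p i && p j) *: (gen i * der j f).
Proof.
apply/csymP => u pu; rewrite coef_der coefD !coefZ (coef_genM _ _ pu).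
have cM : coef (gen i * f) (u + U_(j)) = if adm p (u + U_(j)) then
   if ((u + U_(j))%MM i == 0)%N then 0 else
   ksign k p U_(i) (u + U_(j) - U_(i)) * coef f (u + U_(j) - U_(i)) else 0.
  by case: ifP => [/coef_genM ->//|/negbT/coef_nadm->].
rewrite cM coef_der; have [<-|ne] := eqVneq j i.
  rewrite andbb addmK mnmDE mnm1E eqxx addn1 /= mul1r mnmBE mnm1E eqxx subn1.
  case: ifP => [pu'|/negP pu'].
    rewrite mulrACA ksign_sqr mul1r.
    case: (eqVneq (u j) 0%N) => [->|uj]; first by rewrite mulr0 addr0 mul1r.
    (* p j odd would make [u + U_(j)] contain the generator [j] twice *)
  have npj : p j = false.
      apply/negbTE/negP => pj; have /forallP/(_ j) := pu'.
      by rewrite pj mnmDE mnm1E eqxx addn1 ltnS leqn0 (negPf uj).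
    rewrite npj mul1r submK ?lep1mP // prednK ?lt0n //.
    by rewrite mulrA mulrA ksign_sqr mul1r mulrS mulrDl mul1r.
  (* the term [i] of the right-hand side cancels [coef f u] in this case *)
  have /andP[pj /eqP uj] : p j && (u j == 1%N).
    apply: contraT => H; case: pu'; apply/forallP => l.
    apply/implyP => pl; have /forallP/(_ l) := pu; rewrite pl /= mnmDE mnm1E.
    have [ejl|] := eqVneq j l; last by rewrite addn0.
    by move: H; rewrite ejl pl /= -ejl; case: (u j) => [|[]].
  rewrite mulr0 pj uj /= submK ?lep1mP ?uj //.
  by rewrite mulr1 [ksign _ _ _ _ * (_ * _)]mulrA ksign_sqr mul1r expr1 mulN1r subrr.
rewrite mul0r add0r mnmDE mnm1E (negPf ne) addn0.
have [ui|ui] := eqVneq (u i) 0%N; first by rewrite !(mulr0, if_same).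
have le_iu : (U_(i) <= u)%MM by rewrite lep1mP.
have -> : (u + U_(j) - U_(i) = u - U_(i) + U_(j))%MM.
  by rewrite -[in LHS](submK le_iu) -addmA [(U_(i) + _)%MM]addmC addmA addmK.
rewrite mnmBE mnm1E eq_sym (negPf ne) subn0.
case: (boolP (adm p (u + U_(j)))) => pu'; last first.
  rewrite [coef f _]coef_nadm ?mulr0 //; apply: contraNN pu' => /forallP pu'.
  apply/forallP => l; apply/implyP => pl; have := implyP (pu' l) pl.
  have := implyP (forallP pu l) pl; rewrite !mnmDE !mnmBE !mnm1E.
  have [<-|_] := eqVneq j l; last by rewrite !addn0.
  by rewrite [i == j]eq_sym (negPf ne) subn0.
rewrite -(ksignUU (i := i) (j := j)) 1?eq_sym // -[in ksign k p U_(j) u](submK le_iu).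
rewrite !ksignDr; ring.
Qed.

Lemma der_one j : der j (1 : csym G) = 0.
Proof.
apply/csymP => u pu; rewrite coef_der coef_one coef0.
by rewrite -[_ == _]negbK -mdeg_eq0 mdegD mdeg1 addn1 mulr0.
Qed.

Lemma der_gen j i : der j (gen i : csym G) = (j == i)%:R *: 1.
Proof. by rewrite -[gen i : csym G]mulr1 der_genM der_one mulr0 scaler0 addr0. Qed.

Lemma der_Mgen c j i f : has_parity c f ->
  der j (f * gen i) = der j f * gen i + (-1) ^+ (c && p j) * (j == i)%:R *: f.
Proof.
move=> fc; rewrite (csym_mulC fc (@has_parity_gen i)) linearZ /= der_genM.
rewrite (csym_mulC (@has_parity_gen i) (has_parity_der (i := j) fc)).
rewrite scalerDr !scalerA addrC; congr (_ + _).
  rewrite -[RHS]scale1r -!signr_addb; congr (_ *: _).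
  by case: c fc (p i) (p j) => _ [] [].
by have [->|_] := eqVneq j i; rewrite ?mulr0 ?scale0r ?mulr1.
Qed.

Lemma der_comm i j f : i != j ->
  der i (der j f) = (-1) ^+ (p i && p j) *: der j (der i f).
Proof.
move=> ne; apply/csymP => u _; rewrite coefZ !coef_der.
rewrite !mnmDE !mnm1E (negPf ne) [j == i]eq_sym (negPf ne) !addn0.
rewrite !ksignDr -(ksignUU ne) -!addmA [(U_(j) + _)%MM]addmC.
rewrite [LHS]mulrACA [RHS]mulrCA.
have := ksign_sqr U_(i) U_(j); move: (ksign k p U_(i) U_(j)) => s ss.
transitivity (s * s * (ksign k p U_(i) u * (u i).+1%:R *
  (ksign k p U_(j) u * ksign k p U_(j) U_(i) * (u j).+1%:R *
   coef f (u + (U_(i) + U_(j)))))); last by ring.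
rewrite ss; ring.
Qed.


(** * Continuous derivations are determined by the generators *)
Definition monom a : csym G := fun v => (val v == a)%:R.

Lemma coef_monom a u : adm p u -> coef (monom a) u = (u == a)%:R.
Proof. exact: (@coef_fun _ _ _ (fun u => (u == a)%:R)). Qed.

Lemma monom0 : monom 0%MM = 1.
Proof. by []. Qed.

Lemma gen_monom i a : a i != 0%N ->
  gen i * monom (a - U_(i)) = ksign k p U_(i) (a - U_(i)) *: monom a.
Proof.
move=> ai; apply/csymP => u pu; rewrite coefZ coef_genM // (coef_monom _ pu).
have le_ia : (U_(i) <= a)%MM by rewrite lep1mP.
case: ifP => [/eqP ui|/negbT ui].
  rewrite (_ : (u == a) = false) ?mulr0 //.
  by apply: contraNF ai => /eqP <-; rewrite ui.
have le_iu : (U_(i) <= u)%MM by rewrite lep1mP.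
rewrite coef_monom ?(adm_le (lem_subr _ _)) //.

have -> : (u == a) = (u - U_(i) == a - U_(i))%MM.
  by rewrite -[RHS](eqm_add2r U_(i)) !submK.
by case: eqP => [->|]; rewrite ?mulr0.
Qed.

Lemma monom_expansion N f :
  order_ge N (f - \sum_(a : 'X_{1..n < N}) coef f a *: monom a).
Proof.
apply/order_geP => u lt_u; case: (boolP (adm p u)) => pu; last by rewrite coef_nadm.
rewrite coefD -scaleN1r coefZ coef_sum (bigD1 (BMultinom lt_u)) //= coefZ.
rewrite coef_monom // eqxx mulr1 big1 ?addr0 ?mulN1r ?subrr // => a ne.
rewrite coefZ coef_monom // -[u]/(val (BMultinom lt_u)) val_eqE eq_sym.
by rewrite (negPf ne) mulr0.
Qed.

Lemma order_ge_der N i f : order_ge N.+1 f -> order_ge N (der i f).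
Proof.
move=> /order_geP fN; apply/order_geP => u lt_u.
by rewrite coef_der fN ?mulr0 // mdegD mdeg1 addn1.
Qed.

Section Derivation.
Variables (b : bool) (X : csym G -> csym G).
Hypothesis X_der : is_derivation b X.

Lemma derivation_gen_parity i : has_parity (b (+) p i) (X (gen i)).
Proof. by case: X_der => _ + _ _; apply; apply: has_parity_gen. Qed.

Lemma derivation1 : X 1 = 0.
Proof.
have [_ _ XM _] := X_der.
have p1 : has_parity false (1 : csym G).
  move=> u; rewrite -coef_val coef_one; case: (val u =P _) => [->|_].
    by rewrite /mpar big1 // => i; rewrite mnm0E.
  by rewrite eqxx.
have := XM _ _ 1 p1; rewrite andbF scale1r !mulr1 mul1r => e.
by apply: (addrI (X 1)); rewrite addr0 -e.
Qed.

(** The difference [R] of the two sides vanishes on monomials, by induction on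
    the degree, because both sides obey the same Leibniz rule for a product with
    a generator.  A given coefficient of [R f] depends on a finite truncation of
    [f] only, by continuity of [X] and because a partial derivative lowers the
    order by at most one. *)
Lemma derivation_expansion f : X f = \sum_i X (gen i) * der i f.
Proof.
have [Xlin Xpar XM Xcont] := X_der.
pose R f := X f - \sum_i X (gen i) * der i f.
have Rlin : linear R.
  move=> t g h; rewrite /R Xlin scalerBr [RHS]addrACA -opprD; congr (_ - _).
  rewrite scaler_sumr -big_split; apply: eq_bigr => i _ /=.
  by rewrite linearP mulrDr scalerAr.
have RD g h : R (g + h) = R g + R h by rewrite -[g]scale1r Rlin !scale1r.
have R0 : R 0 = 0 by apply: (addrI (R 0)); rewrite -RD !addr0.
have RZ t g : R (t *: g) = t *: R g by rewrite -[t *: g]addr0 Rlin R0 addr0.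
have R_gen i g : R (gen i * g) = (-1) ^+ (b && p i) *: (gen i * R g).
  have E : \sum_j X (gen j) * der j (gen i * g) =
      X (gen i) * g + (-1) ^+ (b && p i) *: (gen i * \sum_j X (gen j) * der j g).
    transitivity (\sum_j (X (gen j) * ((j == i)%:R *: g)
        + (-1) ^+ (b && p i) *: (gen i * (X (gen j) * der j g)))).
      apply: eq_bigr => j _; rewrite der_genM mulrDr; congr (_ + _).
      rewrite -scalerAr !mulrA.
      rewrite (csym_mulC (@derivation_gen_parity j) (@has_parity_gen i)).
      rewrite -scalerAl scalerA -signr_addb; congr ((-1) ^+ nat_of_bool _ *: _).
      by case: (b) (p i) (p j) => [] [] [].
    rewrite big_split /= -scaler_sumr -big_distrr; congr (_ + _).
    rewrite (bigD1 i) //= eqxx scale1r big1 ?addr0 // => j /negPf->.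
    by rewrite scale0r mulr0.
  rewrite /R E (XM _ _ _ (@has_parity_gen i)).
  by rewrite opprD addrACA subrr add0r -scalerBr -mulrBr.
have R_monom a : R (monom a) = 0.
  move: {2}(mdeg a) (leqnn (mdeg a)) => d; elim: d a => [|d IHd] a led.
    have -> : a = 0%MM by apply/eqP; rewrite -mdeg_eq0 -leqn0.
    rewrite monom0 /R derivation1 big1 ?subrr // => i _.
    by rewrite der_one mulr0.
  case: (pickP (fun i => a i != 0%N)) => [i ai|a0]; last first.
    apply: IHd; have -> : a = 0%MM; last by rewrite mdeg0.
    by apply/mnmP => i; rewrite mnm0E; apply/eqP; move/negbFE: (a0 i).
  have -> : monom a = ksign k p U_(i) (a - U_(i)) *: (gen i * monom (a - U_(i))).
    by rewrite gen_monom // scalerA ksign_sqr scale1r.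
  rewrite RZ R_gen IHd ?mulr0 ?scaler0 //.
  have le_ia : (U_(i) <= a)%MM by rewrite lep1mP.
  by move: led; rewrite -{1}(submK le_ia) mdegD mdeg1 addn1.
(* compare the coefficients at [u] after cutting [f] at a degree [N] beyond
   which neither side of the identity contributes to them *)
suff R_eq0 : R f = 0 by apply/eqP; rewrite -subr_eq0; apply/eqP.
apply/csymP => u pu; rewrite coef0.
have [M XM1] := Xcont (mdeg u).+1.
pose N := maxn M (mdeg u).+2.
pose g := \sum_(a : 'X_{1..n < N}) coef f a *: monom a.
have Rg : R g = 0.
  rewrite /g; elim/big_ind: _ => [//|g1 g2 e1 e2|a _].
    by rewrite RD e1 e2 addr0.
  by rewrite RZ R_monom scaler0.
have -> : R f = R (f - g) by rewrite RD -scaleN1r RZ Rg scaler0 addr0.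
have f_g := @monom_expansion N f; rewrite -/g in f_g.
have ge_le N1 N2 h : (N1 <= N2)%N -> order_ge N2 h -> order_ge N1 h.
  by move=> le12 hN v lt_v; apply: hN; apply: leq_trans le12.
have : order_ge (mdeg u).+1 (R (f - g)).
  rewrite /R; set s := \sum_i _; suff s_ge : order_ge (mdeg u).+1 s.
    have X_ge : order_ge (mdeg u).+1 (X (f - g)).
      by apply: XM1; apply: ge_le f_g; apply: leq_maxl.
    apply/order_geP => v lt_v; rewrite coefD coefN.
    move/order_geP: X_ge => -> //; move/order_geP: s_ge => -> //.
    by rewrite subrr.
  apply: order_ge_sum => i _; rewrite -[_.+1]add0n.
  apply: order_geM; first by [].
  by apply: order_ge_der; apply: ge_le f_g; apply: leq_maxr.
by move=> /order_geP; apply.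
Qed.

Lemma derivationZ (t : k) f : X (t *: f) = t *: X f.
Proof.
rewrite !derivation_expansion scaler_sumr.
by apply: eq_bigr => i _; rewrite linearZ scalerAr.
Qed.

End Derivation.
End Algebra.

(** * Functions on the double and their restriction to the locus xi = 0 *)
Section Restriction.
Variables (k : fieldType) (n : nat) (V : dgspace k n).
Local Notation H := (dgPi (dgdual V)).
Local Notation G := (dgPi (dgdual (dgdouble V))).
Local Notation x := (@lshift n n).
Local Notation xi := (@rshift n n).
Implicit Types (f g : cfun V) (F : cfun (dgdouble V)).
Implicit Types (a b : 'X_{1..n}) (u v : 'X_{1..n + n}) (i j : 'I_n).

Lemma split_x i : fintype.split (x i) = inl i.
Proof. exact: (@unsplitK n n (inl i)). Qed.

Lemma split_xi i : fintype.split (xi i) = inr i.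
Proof. exact: (@unsplitK n n (inr i)). Qed.

Lemma par_x i : par G (x i) = par H i.
Proof. by rewrite /= /sum_par split_x. Qed.

Lemma par_xi i : par G (xi i) = ~~ par H i.
Proof. by rewrite /= /sum_par split_xi. Qed.

Lemma dmx_Pi_dual m (W : dgspace k m) (i j : 'I_m) :
  dmx (dgPi (dgdual W)) j i = (-1) ^+ par W i * dmx W i j.
Proof. by rewrite [LHS]mxE [dual_dmx _ _ _]mxE mulNr opprK. Qed.

Lemma dmx_xx i j : dmx G (x i) (x j) = dmx H i j.
Proof.
by rewrite !dmx_Pi_dual /= /sum_par split_x /sum_dmx block_mxEul.
Qed.

Lemma dmx_xxi i j : dmx G (x i) (xi j) = 0.
Proof. by rewrite dmx_Pi_dual /= /sum_dmx block_mxEdl mxE mulr0. Qed.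

Lemma dmx_xix i j : dmx G (xi i) (x j) = 0.
Proof. by rewrite dmx_Pi_dual /= /sum_dmx block_mxEur mxE mulr0. Qed.

(** The two dualizations cancel: the differential on the [xi_i], which form a
    basis of [V] itself, is that of [V]. *)
Lemma dmx_xixi i j : dmx G (xi j) (xi i) = dmx V j i.
Proof.
rewrite dmx_Pi_dual /= /sum_par split_xi /sum_dmx block_mxEdr dmx_Pi_dual /=.
have [->|/dmx_odd] := eqVneq (dmx V j i) 0; first by rewrite !mulr0.
by case: (par V i); case: (par V j) => //= _; rewrite ?expr0 ?expr1; ring.
Qed.

Definition mnm_ext a : 'X_{1..n + n} :=
  [multinom if fintype.split i is inl j then a j else 0%N | i < n + n].

Definition mnm_res u : 'X_{1..n} := [multinom u (x i) | i < n].

Definition xi_free u := [forall j, u (xi j) == 0%N].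

Lemma ext_x a i : mnm_ext a (x i) = a i.
Proof. by rewrite mnmE split_x. Qed.

Lemma ext_xi a i : mnm_ext a (xi i) = 0%N.
Proof. by rewrite mnmE split_xi. Qed.

Lemma multinom_split u v :
  (forall i, u (x i) = v (x i)) -> (forall i, u (xi i) = v (xi i)) -> u = v.
Proof.
by move=> ex exi; apply/mnmP => i; case: (splitP i) => j e;
  [rewrite (_ : i = x j) | rewrite (_ : i = xi j)] => //; apply: val_inj.
Qed.

Lemma extK : cancel mnm_ext mnm_res.
Proof. by move=> a; apply/mnmP => i; rewrite mnmE ext_x. Qed.

Lemma resK u : xi_free u -> mnm_ext (mnm_res u) = u.
Proof.
move=> /forallP u0; apply: multinom_split => i; rewrite ?ext_x ?ext_xi ?mnmE //.
by rewrite (eqP (u0 i)).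
Qed.

Lemma xi_free_ext a : xi_free (mnm_ext a).
Proof. by apply/forallP => j; rewrite ext_xi. Qed.

Lemma extD a b : (mnm_ext (a + b) = mnm_ext a + mnm_ext b)%MM.
Proof. by apply: multinom_split => i; rewrite mnmDE ?ext_x ?ext_xi ?mnmDE. Qed.

Lemma extB a b : (mnm_ext (a - b) = mnm_ext a - mnm_ext b)%MM.
Proof. by apply: multinom_split => i; rewrite mnmBE ?ext_x ?ext_xi ?mnmBE. Qed.

Lemma extU i : mnm_ext U_(i) = U_(x i)%MM.
Proof.
apply: multinom_split => j; rewrite mnm1E ?ext_x ?ext_xi ?mnm1E.
  by rewrite (inj_eq (@lshift_inj _ _)).
by rewrite eq_lrshift.
Qed.

Lemma ext_le a b : (mnm_ext a <= mnm_ext b)%MM = (a <= b)%MM.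
Proof.
apply/mnm_lepP/mnm_lepP => le_ab i; first by have := le_ab (x i); rewrite !ext_x.
case: (splitP i) => j e; [rewrite (_ : i = x j) | rewrite (_ : i = xi j)];
  rewrite ?ext_x ?ext_xi //; exact: val_inj.
Qed.

Lemma mdeg_ext a : mdeg (mnm_ext a) = mdeg a.
Proof.
rewrite [LHS]mdegE [RHS]mdegE big_split_ord /=.
rewrite [X in (_ + X)%N]big1 ?addn0 => [|i _]; last exact: ext_xi.
by apply: eq_bigr => i _; rewrite ext_x.
Qed.

Lemma mpar_ext a : mpar (par G) (mnm_ext a) = mpar (par H) a.
Proof.
rewrite /mpar big_split_ord /=.
rewrite [X in (_ + X)%N]big1 ?addn0 => [|i _]; last exact: ext_xi.
by congr odd; apply: eq_big => [i|i _]; [exact: par_x | exact: ext_x].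
Qed.

Lemma adm_ext a : adm (par G) (mnm_ext a) = adm (par H) a.
Proof.
apply/forallP/forallP => adm_a i.
  by have := adm_a (x i); rewrite par_x ext_x.
case: (splitP i) => j e; [rewrite (_ : i = x j) | rewrite (_ : i = xi j)];
  rewrite ?par_x ?ext_x ?ext_xi ?implybT //; exact: val_inj.
Qed.

Lemma ksign_ext a b : ksign k (par G) (mnm_ext a) (mnm_ext b) = ksign k (par H) a b.
Proof.
rewrite /ksign big_split_ord /= [X in (_ + X)%N]big1 ?addn0 => [|i _]; last first.
  by rewrite big1 // => j _; rewrite ext_xi.
congr (_ ^+ _); apply: eq_bigr => i _.
rewrite big_split_ord /= [X in (_ + X)%N]big1 ?addn0 => [|j _]; last first.
  by rewrite ext_xi muln0.
apply: eq_big => [j|j _]; last by rewrite !ext_x.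
by move: (par_x i) (par_x j) => /= -> ->.
Qed.

(** Evaluation at [xi = 0]. *)
Definition restr F : cfun V := fun w => coef F (mnm_ext (val w)).

Lemma coef_restr F a : coef (restr F) a = coef F (mnm_ext a).
Proof.
case: (boolP (adm (par H) a)) => pa.
  exact: (@coef_fun _ _ _ (fun a => coef F (mnm_ext a))).
by rewrite !coef_nadm ?adm_ext.
Qed.

Lemma coef_incl f u : coef (incl f) u = if xi_free u then coef f (mnm_res u) else 0.
Proof.
case: (boolP (adm (par G) u)) => pu.
  exact: (@coef_fun _ _ _
    (fun u => if xi_free u then coef f (mnm_res u) else 0)).
rewrite coef_nadm //; case: ifP => // free.
by rewrite coef_nadm // -adm_ext resK.
Qed.

Lemma restr_linear : linear restr.
Proof. by move=> t f g; apply/csymP => u _; rewrite !(coefD, coefZ, coef_restr). Qed.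

HB.instance Definition _ :=
  GRing.isLinear.Build k (cfun (dgdouble V)) (cfun V) *:%R restr restr_linear.

Lemma incl_linear : linear (@incl k n V).
Proof.
move=> t f g; apply/csymP => u _; rewrite !(coefD, coefZ, coef_incl).
by case: ifP; rewrite // mulr0 addr0.
Qed.

HB.instance Definition _ :=
  GRing.isLinear.Build k (cfun V) (cfun (dgdouble V)) *:%R (@incl k n V)
    incl_linear.

Lemma inclK : cancel (@incl k n V) restr.
Proof.
by move=> f; apply/csymP => u _; rewrite coef_restr coef_incl xi_free_ext extK.
Qed.

(** This reduces identities between series without [xi] to identities in
    [cfun V]: both sides are compared after restriction. *)
Lemma restrK F : (forall u, coef F u != 0 -> xi_free u) -> incl (restr F) = F.
Proof.
move=> Ffree; apply/csymP => u _; rewrite coef_incl.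
case: ifP => [free|/negP nfree].
  by rewrite coef_restr resK.
by have [->|/Ffree] := eqVneq (coef F u) 0.
Qed.

Lemma incl_free f u : coef (incl f) u != 0 -> xi_free u.
Proof. by rewrite coef_incl; case: ifP; rewrite ?eqxx. Qed.

Lemma xi_freeD u v : xi_free u -> xi_free v -> xi_free (u + v).
Proof.
move=> /forallP u0 /forallP v0; apply/forallP => j.
by rewrite mnmDE (eqP (u0 j)) (eqP (v0 j)).
Qed.

(** A factorization of a monomial in the [x_i] involves no [xi_j], so [mnm_ext]
    reindexes the sum that defines the product. *)
Lemma restrM F F' : restr (F * F') = restr F * restr F'.
Proof.
apply/csymP => a pa; rewrite coef_restr (coefM _ _ pa (ltnSn _)).
have pea : adm (par G) (mnm_ext a) by rewrite adm_ext.
rewrite (@coefM _ _ _ _ _ _ (mdeg a).+1) ?mdeg_ext //.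
have lt_ext (c : 'X_{1..n < (mdeg a).+1}) : (mdeg (mnm_ext c) < (mdeg a).+1)%N.
  by rewrite mdeg_ext bmdeg.
have lt_res (c : 'X_{1..(n + n)%N < (mdeg a).+1}) :
    (mdeg (mnm_res c) < (mdeg a).+1)%N.
  apply: leq_ltn_trans (bmdeg c).
  rewrite mdegE [leqRHS]mdegE big_split_ord /=.
  rewrite (eq_bigr (fun i => c (x i))) ?leq_addr // => i _.
  by rewrite mnmE.
rewrite (reindex_onto (fun c => BMultinom (lt_ext c))
                      (fun c => BMultinom (lt_res c))) /=.
  apply: eq_big => [c|c _]; last by rewrite -extB ksign_ext !coef_restr.
  by rewrite ext_le -val_eqE /= extK eqxx andbT.
move=> c le_ca; apply/val_inj/resK; apply/forallP => j.
by have /mnm_lepP/(_ (xi j)) := le_ca; rewrite ext_xi leqn0.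
Qed.

Lemma inclM f g : incl (f * g) = incl f * incl g.
Proof.
rewrite -[RHS]restrK ?restrM ?inclK // => u.
apply: contraNT => nfree; case: (boolP (adm (par G) u)) => pu; last by rewrite coef_nadm.
rewrite (coefM _ _ pu (ltnSn _)) big1 // => a le_au.
apply/eqP; apply: contraNT nfree; rewrite !mulf_eq0 !negb_or => /and3P[_ fa ga].
by rewrite -(submK le_au) xi_freeD ?(incl_free fa) ?(incl_free ga).
Qed.

Lemma restr_der i F : restr (der (x i) F) = der i (restr F).
Proof.
apply/csymP => a _; rewrite !(coef_der, coef_restr) extD extU ext_x.
by rewrite -extU ksign_ext.
Qed.

Lemma der_incl i f : der (x i) (incl f) = incl (der i f).
Proof.
rewrite -[LHS]restrK ?restr_der ?inclK // => u.
rewrite coef_der mulf_eq0 negb_or => /andP[_ /incl_free/forallP free].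
apply/forallP => j; have := free j; rewrite mnmDE mnm1E eq_lrshift addn0 //.
Qed.

Lemma der_xi_incl i f : der (xi i) (incl f) = 0.
Proof.
apply/csymP => u _; rewrite coef_der coef0 coef_incl.
case: ifP => [/forallP/(_ i)|]; last by rewrite mulr0.
by rewrite mnmDE mnm1E eqxx addn1.
Qed.

Lemma incl_gen i : incl (gen i : cfun V) = gen (x i).
Proof.
apply/csymP => u pu; rewrite coef_incl (coef_gen _ pu).
case: (boolP (xi_free u)) => [free|nfree].
  rewrite coef_gen -?adm_ext ?resK //.
  by rewrite -(can_eq extK) resK // extU.
by case: (u =P _) nfree => // ->; rewrite -extU xi_free_ext.
Qed.

Lemma restr_gen_x i : restr (gen (x i)) = gen i :> cfun V.
Proof. by rewrite -incl_gen inclK. Qed.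

Lemma restr_gen_xi i : restr (gen (xi i)) = 0.
Proof.
apply/csymP => u pu; rewrite coef_restr coef_gen ?adm_ext // coef0.
by case: eqP => // /mnmP/(_ (xi i)); rewrite ext_xi mnm1E eqxx.
Qed.

Lemma has_parity_incl c f : has_parity c f -> has_parity c (incl f).
Proof.
move=> /has_parityP fc; apply/has_parityP => u.
rewrite coef_incl; case: ifP => [free /fc|]; last by rewrite eqxx.
by rewrite -mpar_ext resK.
Qed.

Lemma order_ge_incl N f : order_ge N f -> order_ge N (incl f).
Proof.
move=> /order_geP fN; apply/order_geP => u lt_u.
by rewrite coef_incl; case: ifP => // free; apply: fN; rewrite -mdeg_ext resK.
Qed.

Lemma has_parity_restr c F : has_parity c F -> has_parity c (restr F).
Proof.
move=> /has_parityP Fc; apply/has_parityP => u; rewrite coef_restr => /Fc.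
by rewrite mpar_ext.
Qed.

Lemma order_ge_restr N F : order_ge N F -> order_ge N (restr F).
Proof.
move=> /order_geP FN; apply/order_geP => u lt_u.
by rewrite coef_restr FN // mdeg_ext.
Qed.

Lemma restr_dsym F : restr (dsym F) = dsym (restr F).
Proof.
rewrite /dsym raddf_sum big_split_ord /= [X in _ + X]big1 ?addr0 => [|i _].
  apply: eq_bigr => i _; rewrite restrM restr_der raddf_sum big_split_ord /=.
  rewrite [X in (_ + X) * _]big1 ?addr0 => [|j _]; last first.
    by rewrite linearZ /= restr_gen_xi scaler0.
  by congr (_ * _); apply: eq_bigr => j _; rewrite linearZ /= restr_gen_x dmx_xx.
rewrite restrM raddf_sum big_split_ord /= !big1 ?addr0 ?mul0r // => j _.
  by rewrite linearZ /= restr_gen_xi scaler0.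
by rewrite linearZ /= dmx_xxi scale0r.
Qed.

Lemma dsym_incl f : dsym (incl f) = incl (dsym f).
Proof.
rewrite /dsym raddf_sum big_split_ord /= [X in _ + X]big1 ?addr0 => [|i _]; last first.
  by rewrite der_xi_incl mulr0.
apply: eq_bigr => i _; rewrite der_incl inclM raddf_sum big_split_ord /=.
rewrite [X in (_ + X) * _]big1 ?addr0 => [|j _]; last by rewrite dmx_xix scale0r.
by congr (_ * _); apply: eq_bigr => j _; rewrite linearZ /= incl_gen dmx_xx.
Qed.

End Restriction.

(** * The differential and the odd Poisson bracket *)
Section Differential.
Variables (k : fieldType) (n : nat) (G : dgspace k n).
Local Notation p := (par G).
Implicit Types (f g : csym G) (i j : 'I_n).

Lemma dsym_linear : linear (@dsym k n G).
Proof.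
move=> t f g; rewrite /dsym scaler_sumr -big_split; apply: eq_bigr => i _ /=.
by rewrite linearP mulrDr scalerAr.
Qed.

HB.instance Definition _ :=
  GRing.isLinear.Build k (csym G) (csym G) *:%R (@dsym k n G) dsym_linear.

Lemma dsym_gen i : dsym (gen i : csym G) = \sum_j dmx G j i *: gen j.
Proof.
rewrite /dsym (bigD1 i) //= der_gen eqxx scale1r mulr1.
rewrite [X in _ + X]big1 ?addr0 // => j ne.
by rewrite der_gen (negPf ne) scale0r mulr0.
Qed.

Lemma has_parity_dsym_gen i : has_parity (~~ p i) (dsym (gen i : csym G)).
Proof.
rewrite dsym_gen; apply: has_parity_sum => j _.
have [->|/dmx_odd pij] := eqVneq (dmx G j i) 0.
  by rewrite scale0r; apply: has_parity0.
apply: has_parityZ; rewrite (_ : ~~ p i = p j); first exact: has_parity_gen.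
by case: (p i) (p j) pij => [] [].
Qed.

Lemma dsym_Mgen c f i : has_parity c f ->
  dsym (f * gen i) = dsym f * gen i + (-1) ^+ c *: (f * dsym (gen i)).
Proof.
move=> fc; rewrite (csym_mulC fc (@has_parity_dsym_gen i)) scalerA.
pose D j := \sum_l dmx G l j *: gen l : csym G.
transitivity (\sum_j (D j * der j f * gen i
                      + (-1) ^+ (c && p i) *: (D j * ((j == i)%:R *: f)))).
  apply: eq_bigr => j _; rewrite (der_Mgen _ _ fc) mulrDr mulrA; congr (_ + _).
  rewrite -!scalerAr scalerA.
  by have [->|_] := eqVneq j i; rewrite ?mulr0 ?scale0r // mulr0.
rewrite big_split /= -mulr_suml; congr (_ + _).
rewrite (bigD1 i) //= eqxx scale1r.
rewrite [X in _ + X]big1 ?addr0 => [|j /negPf->]; last first.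
  by rewrite scale0r mulr0 scaler0.
rewrite dsym_gen -signr_addb; congr ((-1) ^+ nat_of_bool _ *: _).
by case: c fc (p i) => _ [].
Qed.

End Differential.

Section OddSymplecticCalculus.
Variables (k : fieldType) (n : nat) (V : dgspace k n).
Local Notation H := (dgPi (dgdual V)).
Local Notation G := (dgPi (dgdual (dgdouble V))).
Local Notation x := (@lshift n n).
Local Notation xi := (@rshift n n).
Implicit Types (F S : cfun (dgdouble V)).

Lemma poisson_even S F : has_parity false S ->
  poisson S F = \sum_i (der (xi i) S * der (x i) F + der (x i) S * der (xi i) F).
Proof.
move=> Sev; apply: eq_bigr => i _.
by rewrite !(parity_signE _ Sev) !andbF !scale1r.
Qed.

(** The parities of [x_i] and [xi_i] are opposite, so the two partial
    derivatives of even functions that are multiplied here commute. *)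
Lemma poisson_even_sym S S' : has_parity false S -> has_parity false S' ->
  poisson S S' = poisson S' S.
Proof.
move=> Sev S'ev; rewrite !poisson_even //; apply: eq_bigr => i _.
rewrite addrC; congr (_ + _).
  rewrite (csym_mulC (has_parity_der (i := x i) Sev)
                     (has_parity_der (i := xi i) S'ev)).
  by rewrite par_x par_xi; case: (par H i); rewrite scale1r.
rewrite (csym_mulC (has_parity_der (i := xi i) Sev)
                   (has_parity_der (i := x i) S'ev)).
by rewrite par_x par_xi; case: (par H i); rewrite scale1r.
Qed.

Lemma poisson0l F : poisson (0 : cfun (dgdouble V)) F = 0.
Proof.
rewrite (poisson_even _ (@has_parity0 _ _ _ _)) big1 // => i _.
by rewrite !linear0 !mul0r addr0.
Qed.

Lemma poisson0r F : poisson F (0 : cfun (dgdouble V)) = 0.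
Proof. by rewrite /poisson big1 // => i _; rewrite !linear0 !mulr0 addr0. Qed.

Lemma poisson_incl (f g : cfun V) :
  has_parity false f -> poisson (incl f) (incl g) = 0.
Proof.
move=> f_even; rewrite (poisson_even _ (has_parity_incl f_even)) big1 // => i _.
by rewrite !der_xi_incl mul0r mulr0 addr0.
Qed.

Lemma laplacian_incl (f : cfun V) : laplacian (incl f) = 0.
Proof. by rewrite /laplacian big1 // => i _; rewrite der_xi_incl linear0. Qed.

Lemma poisson_gen_x S j : has_parity false S ->
  poisson S (gen (x j)) = der (xi j) S.
Proof.
move=> Sev; rewrite poisson_even // (bigD1 j) //= !der_gen eqxx eq_rlshift.
rewrite scale1r mulr1 scale0r mulr0 addr0 big1 ?addr0 // => i /negPf ne.
by rewrite !der_gen eq_lshift ne eq_rlshift !scale0r !mulr0 addr0.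
Qed.

Lemma poisson_gen_xi S j : has_parity false S ->
  poisson S (gen (xi j)) = der (x j) S.
Proof.
move=> Sev; rewrite poisson_even // (bigD1 j) //= !der_gen eqxx eq_lrshift.
rewrite scale1r mulr1 scale0r mulr0 add0r big1 ?addr0 // => i /negPf ne.
by rewrite !der_gen eq_rshift ne eq_lrshift !scale0r !mulr0 addr0.
Qed.

(** The Hamiltonian field of [S] sends [x_i] to [der (xi i) S] and [xi_i] to
    [der (x i) S], so the two halves of the coordinates contribute one Laplacian
    each; every sign is trivial because [x_i] or [xi_i] is even. *)
Lemma divergence_poisson S : has_parity false S ->
  divergence (poisson S) = 2%:R *: laplacian S.
Proof.
move=> Sev; rewrite scaler_nat mulr2n /divergence big_split_ord.
congr (_ + _); apply: eq_bigr => i _.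
  rewrite poisson_gen_x // (parity_signE _ (has_parity_der Sev)) par_x par_xi.
  by case: (par H i); rewrite scale1r.
rewrite poisson_gen_xi // (parity_signE _ (has_parity_der Sev)) par_x par_xi.
rewrite addFb andNb scale1r der_comm ?eq_rlshift // par_x par_xi.
by rewrite andNb scale1r.
Qed.

End OddSymplecticCalculus.

(** * The odd double of an L-infinity algebra *)
Section OddDoubleOfLinfty.
Variables (k : fieldType) (k_char0 : [pchar k] =i pred0).
Variables (n : nat) (V : dgspace k n) (m : cfun V -> cfun V).
Hypothesis m_Linfty : Linfty_structure m.
Local Notation H := (dgPi (dgdual V)).
Local Notation G := (dgPi (dgdual (dgdouble V))).
Local Notation x := (@lshift n n).
Local Notation xi := (@rshift n n).
Local Notation S0 := (D_od m).
Local Notation M i := (incl (m (gen i))).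
Implicit Types (f : cfun V) (F : cfun (dgdouble V)).

Let m_der : is_derivation true m. Proof. by case: m_Linfty. Qed.

Lemma two_neq0 : 2%:R != 0 :> k.
Proof. by rewrite ((pcharf0P k).1 k_char0). Qed.

Lemma half_double (W : lmodType k) (w : W) : 2^-1 *: (2%:R *: w) = w.
Proof. by rewrite scalerA mulVf ?scale1r // two_neq0. Qed.

Lemma has_parity_M i : has_parity (~~ par H i) (M i).
Proof. by apply: has_parity_incl; apply: (derivation_gen_parity m_der). Qed.

Lemma D_odE : S0 = \sum_j (-1) ^+ (~~ par H j) *: (M j * gen (xi j)).
Proof.
by apply: eq_bigr => j _; rewrite (parity_signE _ (@has_parity_M j)) scalerAl.
Qed.

Lemma D_od_even : has_parity false S0.
Proof.
rewrite D_odE; apply: has_parity_sum => j _; apply: has_parityZ.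
have := has_parityM (@has_parity_M j) (@has_parity_gen _ _ G (xi j)).
by rewrite par_xi addbb.
Qed.

Lemma D_od_order : order_ge 3 S0.
Proof.
rewrite D_odE; apply: order_ge_sum => j _; apply: order_geZ.
apply: (@order_geM _ _ _ 2 1); last exact: order_ge_gen.
by apply: order_ge_incl; case: m_Linfty.
Qed.

(** The sign in the definition of [D_od] is the one that cancels the sign of
    moving the derivative along [xi_i] past [m (x_i)]. *)
Lemma der_xi_D_od i : der (xi i) S0 = M i.
Proof.
rewrite D_odE raddf_sum (bigD1 i) //= linearZ /= (der_Mgen _ _ (@has_parity_M i)).
rewrite der_xi_incl mul0r add0r eqxx mulr1 par_xi andbb scalerA.
rewrite -signr_addb addbb scale1r big1 ?addr0 // => j ne.
rewrite linearZ /= (der_Mgen _ _ (@has_parity_M j)) der_xi_incl eq_rshift eq_sym.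
by rewrite (negPf ne) mul0r mulr0 scale0r addr0 scaler0.
Qed.

Lemma der_x_D_od i :
  der (x i) S0 = \sum_j (-1) ^+ (~~ par H j) *:
    (incl (der i (m (gen j))) * gen (xi j)).
Proof.
rewrite D_odE raddf_sum; apply: eq_bigr => j _ /=.
rewrite linearZ /= (der_Mgen _ _ (@has_parity_M j)) der_incl eq_lrshift.
by rewrite mulr0 scale0r addr0.
Qed.

Lemma laplacian_D_od : laplacian S0 = incl (divergence m).
Proof.
rewrite /laplacian /divergence raddf_sum; apply: eq_bigr => i _.
rewrite der_xi_D_od der_incl.
rewrite (parity_signE _ (derivation_gen_parity m_der (i := i))).
by case: (par H i); rewrite /= ?scale1r.
Qed.

Lemma poisson_D_od F :
  poisson S0 F = \sum_i (M i * der (x i) F + der (x i) S0 * der (xi i) F).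
Proof.
rewrite (poisson_even _ D_od_even); apply: eq_bigr => i _.
by rewrite der_xi_D_od.
Qed.

Lemma poisson_D_od_incl f : poisson S0 (incl f) = incl (m f).
Proof.
rewrite poisson_D_od (derivation_expansion m_der f) raddf_sum.
by apply: eq_bigr => i _ /=; rewrite der_xi_incl mulr0 addr0 der_incl inclM.
Qed.

(** The terms with [der (x i) S0] disappear, this derivative still being linear
    in the [xi_j]. *)
Lemma restr_poisson_D_od F : restr (poisson S0 F) = m (restr F).
Proof.
rewrite poisson_D_od (derivation_expansion m_der (restr F)) raddf_sum.
apply: eq_bigr => i _; rewrite raddfD /= !restrM inclK restr_der.
rewrite der_x_D_od raddf_sum big1 ?mul0r ?addr0 // => j _ /=.
by rewrite linearZ /= restrM restr_gen_xi mulr0 scaler0.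
Qed.

Lemma Linfty_gen j :
  dsym (m (gen j)) + m (m (gen j)) + \sum_i dmx H i j *: m (gen i) = 0.
Proof.
have [_ _ /(_ (gen j))] := m_Linfty.
have m_sum (I : finType) (c : I -> k) (g : I -> cfun V) :
    m (\sum_i c i *: g i) = \sum_i c i *: m (g i).
  rewrite (derivation_expansion m_der).
  under eq_bigr do rewrite raddf_sum mulr_sumr.
  rewrite exchange_big; apply: eq_bigr => i _ /=.
  rewrite [in RHS](derivation_expansion m_der) scaler_sumr.
  by apply: eq_bigr => l _; rewrite linearZ scalerAr.
rewrite /scomm /= expr1 !scaleN1r !opprK dsym_gen m_sum -mulr2n -scaler_nat.
by rewrite half_double addrAC.
Qed.

Lemma poisson_D_od_D_od : poisson S0 S0 =
  2%:R *: (\sum_j (-1) ^+ (~~ par H j) *: (incl (m (m (gen j))) * gen (xi j))).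
Proof.
have -> : poisson S0 S0 = 2%:R *: (\sum_i M i * der (x i) S0).
  rewrite poisson_D_od scaler_nat mulr2n -big_split; apply: eq_bigr => i _ /=.
  congr (_ + _); rewrite der_xi_D_od.
  rewrite (csym_mulC (has_parity_der (i := x i) D_od_even) (@has_parity_M i)).
  rewrite par_x.
  by case: (par H i); rewrite scale1r.
congr (_ *: _).
transitivity (\sum_i \sum_j (-1) ^+ (~~ par H j) *:
    (incl (m (gen i) * der i (m (gen j))) * gen (xi j))).
  apply: eq_bigr => i _; rewrite der_x_D_od mulr_sumr; apply: eq_bigr => j _.
  by rewrite -scalerAr mulrA inclM.
rewrite exchange_big; apply: eq_bigr => j _ /=.
rewrite [in RHS](derivation_expansion m_der (m (gen j))) raddf_sum mulr_suml.
by rewrite scaler_sumr.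
Qed.

Lemma dsym_D_od : dsym S0 = \sum_j (-1) ^+ (~~ par H j) *:
  (incl (dsym (m (gen j)) + \sum_i dmx H i j *: m (gen i)) * gen (xi j)).
Proof.
rewrite D_odE raddf_sum.
transitivity (\sum_j ((-1) ^+ (~~ par H j) *:
    (incl (dsym (m (gen j))) * gen (xi j))
    + M j * dsym (gen (xi j)))).
  apply: eq_bigr => j _ /=; rewrite linearZ /= (dsym_Mgen _ (@has_parity_M j)).
  by rewrite dsym_incl scalerDr scalerA -signr_addb addbb scale1r.
rewrite big_split /=.
(* [d xi_i] involves [xi_j] with the matrix coefficient that has [x_i] in [d x_j],
   up to the parity sign: hence the exchange of the two sums *)
transitivity (\sum_j (-1) ^+ (~~ par H j) *:
    (incl (dsym (m (gen j))) * gen (xi j))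
  + \sum_j \sum_i (-1) ^+ (~~ par H j) *:
    (incl (dmx H i j *: m (gen i)) * gen (xi j))).
  congr (_ + _); rewrite [RHS]exchange_big /=; apply: eq_bigr => i _.
  rewrite dsym_gen big_split_ord /= [X in X + _]big1 ?add0r => [|j _]; last first.
    by rewrite dmx_xxi scale0r.
  rewrite mulr_sumr; apply: eq_bigr => j _; rewrite dmx_xixi dmx_Pi_dual.
  rewrite linearZ -scalerAr -scalerAl scalerA mulrA -signr_addb /=.
  by rewrite negbK addbb mul1r.
rewrite -big_split; apply: eq_bigr => j _ /=.
by rewrite -scaler_sumr -scalerDr -mulr_suml -raddf_sum -mulrDl -raddfD.
Qed.

(** The coefficient of [xi_j] is the Maurer-Cartan equation of [m] on [x_j]. *)
Lemma D_od_master : dsym S0 + 2^-1 *: poisson S0 S0 = 0.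
Proof.
rewrite poisson_D_od_D_od half_double dsym_D_od -big_split big1 // => j _ /=.
rewrite -scalerDr -mulrDl -raddfD addrAC Linfty_gen.
by rewrite raddf0 mul0r scaler0.
Qed.

Lemma unimodular_doubleE F :
  dsym F + 2^-1 *: divergence (poisson S0) + poisson S0 F
  = dsym F + incl (divergence m) + poisson S0 F.
Proof. by rewrite (divergence_poisson D_od_even) half_double laplacian_D_od. Qed.

(** The factor [1/2] accounts for the divergence of [m] entering the equation of
    the double with coefficient [1], and that of [m] with coefficient [1/2]. *)
Lemma unimodular_lift_restr F : unimodular_lift (poisson S0) F ->
  unimodular_lift m (2^-1 *: restr F).
Proof.
case=> F_even F_ge1 F_eq; split.
- by apply: has_parityZ; apply: has_parity_restr.
- by apply: order_geZ; apply: order_ge_restr.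
rewrite linearZ (derivationZ m_der) /=.
have /(congr1 (@restr k n V)) := F_eq; rewrite unimodular_doubleE !raddfD /=.
rewrite restr_dsym restr_poisson_D_od inclK raddf0 => e.
by rewrite -scalerDr -scalerDr e scaler0.
Qed.

(** The equation is the coefficient of [h]; the weight condition on [S 1] says
    precisely that it has no constant term. *)
Lemma quantum_lift_unimodular S : quantum_lift S0 S ->
  unimodular_lift (poisson S0) (S 1%N).
Proof.
case=> S_0 S_even S_weight S_eq; split => //.
  move=> u; rewrite ltnS leqn0 => /eqP deg0; apply/eqP; apply: contraT.
  by move=> /S_weight; rewrite deg0.
have := S_eq 1%N; rewrite big_ord_recr big_ord1 /= S_0.
rewrite (poisson_even_sym (S_even 1%N) D_od_even) -mulr2n -scaler_nat.
by rewrite half_double laplacian_D_od unimodular_doubleE.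
Qed.

(** The weight condition is met because [S0] has order at least 3 and [f], which
    is multiplied by [h], has order at least 1. *)
Lemma unimodular_quantum_lift f : unimodular_lift m f ->
  quantum_lift S0
    (fun r => match r with 0 => S0 | 1 => incl (2%:R *: f) | _ => 0 end).
Proof.
case=> f_even f_ge1 f_eq; split=> //.
- case=> [|[|r]]; [exact: D_od_even | | exact: has_parity0].
  by apply: has_parity_incl; apply: has_parityZ.
- case=> [|[|r]] u; last by rewrite eqxx.
    by apply: contraNT; rewrite -leqNgt => le; apply/eqP; apply: D_od_order.
  apply: contraNT; rewrite -leqNgt => le; apply/eqP.
  have := order_ge_incl (order_geZ 2%:R f_ge1); apply.
  by move: le; rewrite muln1 -[leqRHS]addn0 leq_add2l leqn0 => /eqP ->.
case=> [|[|r]].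
- by rewrite addr0 big_ord1 subnn; apply: D_od_master.
- rewrite big_ord_recr big_ord1 /=.
  have S1_even := has_parity_incl (has_parityZ (t := 2%:R) f_even).
  rewrite (poisson_even_sym S1_even D_od_even) -mulr2n -scaler_nat half_double.
  rewrite laplacian_D_od poisson_D_od_incl dsym_incl -!raddfD /=.
  have -> : dsym (2%:R *: f) + divergence m + m (2%:R *: f)
            = 2%:R *: (dsym f + 2^-1 *: divergence m + m f).
    rewrite linearZ (derivationZ m_der) !scalerDr scalerA mulfV ?two_neq0 //.
    by rewrite scale1r.
  by rewrite f_eq scaler0 raddf0.
rewrite raddf0 add0r big1 => [|a _]; last first.
  case: (nat_of_ord a) => {a} [|[|b]]; rewrite ?poisson0r ?poisson0l //.
  case: r => [|r]; rewrite subSS ?subn0 ?poisson0r ?poisson_incl //.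
  exact: has_parityZ.
rewrite scaler0 addr0; case: r => [|r]; first exact: laplacian_incl.
by rewrite -[X in laplacian X](raddf0 (@incl k n V)) laplacian_incl.
Qed.

End OddDoubleOfLinfty.

Theorem theorem6p7 (k : fieldType) (k_char0 : [pchar k]%R =i pred0)
    (n : nat) (V : dgspace k n) (m : cfun V -> cfun V)
    (m_Linfty : Linfty_structure m) :
  [<-> exists f : cfun V, unimodular_lift m f;
       exists f : cfun (dgdouble V), unimodular_lift (poisson (D_od m)) f;
       exists S : nat -> cfun (dgdouble V), quantum_lift (D_od m) S].
Proof.
tfae.
- case=> f /(unimodular_quantum_lift k_char0 m_Linfty).
  by move=> /(quantum_lift_unimodular k_char0 m_Linfty); eexists; eassumption.
- case=> F /(unimodular_lift_restr k_char0 m_Linfty).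
  by move=> /(unimodular_quantum_lift k_char0 m_Linfty); eexists; eassumption.
- case=> S /(quantum_lift_unimodular k_char0 m_Linfty).
  by move=> /(unimodular_lift_restr k_char0 m_Linfty); eexists; eassumption.
Qed.
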